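(* The localic completion functor $\overline{(-)}\colon \mathbf{GUS}\to\mathbf{FTop}$ preserves inhabited countable products: for every sequence $((X_n,M_n))_{n\in\mathbb N}$ of generalised uniform spaces such that the set $\prod_{n\in\mathbb N}X_n$ is inhabited, the formal topology $\mathcal U(\prod_{n\in\mathbb N}X_n)$ together with the morphisms $\overline{\pi_n}\colon \mathcal U(\prod_{n\in\mathbb N}X_n)\to\mathcal U(X_n)$ $(n\in\mathbb N)$ induced by the projections $\pi_n$ is a product of the family $(\mathcal U(X_n))_{n\in\mathbb N}$ in $\mathbf{FTop}$.
   Context: Foundations: constructive (Aczel's CZF with the Regular Extension Axiom; neither excluded middle nor choice is assumed). $\mathrm{Pow}(S)$ is the class of subsets of $S$; $\mathrm{Fin}^+(S)$ is the set of inhabited finitely enumerable subsets of $S$ (images of $\{0,\dots,n-1\}$). For a relation $r\subseteq S\times T$ and $D\subseteq T$, $r^-D=\{a\in S\mid \exists b\in D,\ a\,r\,b\}$ and $r^-b=r^-\{b\}$. Formal topologies: a formal topology is $\mathcal S=(S,\lhd,\le)$ with $(S,\le)$ a preordered set and $\lhd$ a relation between $S$ and $\mathrm{Pow}(S)$ (a cover) such that $\{a\mid a\lhd U\}$ is a set for each $U\subseteq S$ and, for all $a,b\in S$, $U,V\subseteq S$: (1) $U\lhd U$; (2) $a\lhd U$ and $U\lhd V$ imply $a\lhd V$; (3) $a\lhd U$ and $a\lhd V$ imply $a\lhd U\downarrow V$; (4) $a\le b$ implies $a\lhd b$. Here $U\lhd V$ means $\forall a\in U\ (a\lhd V)$,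 $U\downarrow V=\{c\mid\exists a\in U\,\exists b\in V\ (c\le a,\ c\le b)\}$, and singletons are written as elements. A formal topology map $r\colon\mathcal S\to\mathcal S'$ is a relation $r\subseteq S\times S'$ with $S\lhd r^-S'$; $r^-a\downarrow r^-b\lhd r^-(a\downarrow' b)$; $a\lhd' U\Rightarrow r^-a\lhd r^-U$. Two maps $r,s$ are equal if $r^-a\lhd s^-a$ and $s^-a\lhd r^-a$ for all $a\in S'$. Composition is composition of relations, the identity is the equality relation. $\mathbf{FTop}$ is the resulting category. The cover inductively generated on a preorder by given axioms $a\lhd C$ is the least cover (making the preorder a formal topology) that satisfies the axioms. Upper reals: $\mathbb R^u$ is the class of subsets $U\subseteq\mathbb Q^{>0}$ with $q\in U\iff\exists q'<q\,(q'\in U)$ (possibly empty). $U\le V$ iff $V\subseteq U$; $U+V=\{q_1+q_2\mid q_1\in U,q_2\in V\}$; a non-negative rational $r$ is identified with $\{q\mid r<q\}$; $U<V$ iff $U+r\le V$ for some $r\in\mathbb Q^{>0}$ (so $U<q\iff q\in U$). Generalised uniform spaces: a generalised metric on $X$ is $d\colon X\times X\to\mathbb R^u$ with $d(x,x)=0$ and $d(x,z)\le d(x,y)+d(y,z)$; generalised metrics are ordered pointwise. A generalised uniform space (gus) is $(X,M)$ with $M$ a set of generalised metrics on $X$ that is inhabited and closed under binary sups. A homomorphism $f\colon(X,M)\to(Y,N)$ is a function such that $\forall\rho\in N\,\exists d\in M\ (d\,\omega_f\,\rho)$, where $d\,\omega_f\,\rho$ means $\forall x,x'\ \rho(f(x),f(x'))\le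 d(x,x')$. $\mathbf{GUS}$ is the category of gus's and homomorphisms. Localic completion: for a gus $(X,M)$ let $U_X=M\times\mathbb Q^{>0}\times X$, with elements written $\mathsf b_d(x,\varepsilon)$. Put $\mathsf b_d(y,\delta)\le_X\mathsf b_\rho(x,\varepsilon)$ iff $\rho\le d$ and $\rho(x,y)+\delta\le\varepsilon$; and $\mathsf b_d(y,\delta)<_X\mathsf b_\rho(x,\varepsilon)$ iff $\rho\le d$ and $\rho(x,y)+\delta<\varepsilon$. $\mathcal U(X)=(U_X,\lhd_X,\le_X)$ where $\lhd_X$ is inductively generated by the axioms, for all $a\in U_X$: (U1) $a\lhd_X\{b\mid b<_Xa\}$; (U2) $a\lhd_X\mathcal C_d^\varepsilon$ for each $d\in M$, $\varepsilon\in\mathbb Q^{>0}$, where $\mathcal C_d^\varepsilon=\{\mathsf b_d(x,\varepsilon)\mid x\in X\}$. The functor $\overline{(-)}$ sends $(X,M)$ to $\mathcal U(X)$ and a homomorphism $f\colon(X,M)\to(Y,N)$ to $\overline f=r_f$, where $\mathsf b_d(x,\varepsilon)\,r_f\,\mathsf b_\rho(y,\delta)$ iff $d\,\omega_f\,\rho$ and $\mathsf b_\rho(f(x),\varepsilon)<_Y\mathsf b_\rho(y,\delta)$ (the latter with the definition of $<_Y$). Products of gus's: the product of a set-indexed family $((X_i,M_i))_{i\in I}$ is the cartesian product $\prod_iX_i$ with the set $M_\Pi=\mathrm{Fin}^+(\sum_{i\in I}M_i)$, where $A\in M_\Pi$ is identified with the generalised metric $A(f,g)=\sup\{d(f(i),g(i))\mid(i,d)\in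 A\}$. The projections $\pi_i$ are homomorphisms. ''Countable product'' means product of a family indexed by $\mathbb N$; it is inhabited if its underlying set is inhabited. *)

(* Defs.v *)
(* Only notations are taken from mathcomp.classical: every definition below is
   axiom-free. *)
From mathcomp Require Import all_boot all_order all_algebra.
From mathcomp Require Import interval_inference classical_sets.
From mathcomp Require Import lra.

Set Implicit Arguments.
Unset Strict Implicit.
Unset Printing Implicit Defensive.

Import Order.TTheory GRing.Theory Num.Theory.

Local Open Scope ring_scope.
Local Open Scope classical_set_scope.

(** * Formal topologies *)

Definition down (S : Type) (le : S -> S -> Prop) (U V : set S) : set S :=
  [set c | exists2 a, U a & exists2 b, V b & le c a /\ le c b].

Definition cover_set (S : Type) (cov : S -> set S -> Prop) (U V : set S) :=
  forall a, U a -> cov a V.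

(* [{a | cov a U}] is a set since [cov] is [Prop]-valued.  That [cov a U] only
   depends on the extension of [U] follows from the first two clauses. *)
Record is_cover (S : Type) (le : S -> S -> Prop) (cov : S -> set S -> Prop) :
    Prop := IsCover {
  cov_refl : forall U, cover_set cov U U;
  cov_trans : forall a U V, cov a U -> cover_set cov U V -> cov a V;
  cov_down : forall a U V, cov a U -> cov a V -> cov a (down le U V);
  cov_le : forall a b, le a b -> cov a [set b]
}.

Record ftop := FTop {
  ft_car :> Type;
  ft_le : ft_car -> ft_car -> Prop;
  ft_cov : ft_car -> set ft_car -> Prop;
  ft_le_refl : forall a, ft_le a a;
  ft_le_trans : forall a b c, ft_le a b -> ft_le b c -> ft_le a c;
  ft_is_cover : is_cover ft_le ft_cov
}.

Definition ft_covs (S : ftop) : set S -> set S -> Prop :=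
  cover_set (@ft_cov S).

(* The cover inductively generated by the axioms [ax]: the intersection of all
   the covers that satisfy them (which is itself a cover). *)
Definition gen_cover (S : Type) (le : S -> S -> Prop)
    (ax : S -> set S -> Prop) (a : S) (U : set S) : Prop :=
  forall cov, is_cover le cov -> (forall b C, ax b C -> cov b C) -> cov a U.

Lemma gen_cover_is_cover S le ax : is_cover le (@gen_cover S le ax).
Proof.
split.
- by move=> U a Ua cov cP _; apply: (cov_refl cP).
- move=> a U V aU UV cov cP axP; apply: (cov_trans cP (aU _ cP axP)).
  by move=> b Ub; apply: UV.
- by move=> a U V aU aV cov cP axP; apply: (cov_down cP); [apply: aU|apply: aV].
- by move=> a b ab cov cP _; apply: (cov_le cP).
Qed.

Lemma gen_cover_ax S le ax a C : ax a C -> @gen_cover S le ax a C.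
Proof. by move=> aC cov _; apply. Qed.

(** * Formal topology maps *)

(* [r^- D] *)
Definition rpre (S T : Type) (r : S -> T -> Prop) (D : set T) : set S :=
  [set a | exists2 b, D b & r a b].

Record is_ftop_map (S T : ftop) (r : S -> T -> Prop) : Prop := IsFTopMap {
  fm_total : ft_covs setT (rpre r setT);
  fm_down : forall a b,
    ft_covs (down (@ft_le S) (rpre r [set a]) (rpre r [set b]))
            (rpre r (down (@ft_le T) [set a] [set b]));
  fm_cov : forall a U, ft_cov a U -> ft_covs (rpre r [set a]) (rpre r U)
}.

Record ftop_map (S T : ftop) := FTopMap {
  fm_rel :> S -> T -> Prop;
  fm_is_map : is_ftop_map fm_rel
}.

(* Equality of parallel morphisms in FTop. *)
Definition ftop_map_eq (S T : ftop) (r s : ftop_map S T) : Prop :=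
  forall a, ft_covs (rpre r [set a]) (rpre s [set a]) /\
            ft_covs (rpre s [set a]) (rpre r [set a]).

Definition rcomp (S T W : Type) (s : T -> W -> Prop) (r : S -> T -> Prop)
    (a : S) (c : W) : Prop :=
  exists2 b, r a b & s b c.

Section CoverTheory.
Variable S : ftop.
Implicit Types (a b : S) (U V W : set S).

Lemma ftcov_mem U a : U a -> ft_cov a U.
Proof. by move=> Ua; apply: (cov_refl (ft_is_cover S)). Qed.

Lemma ftcov_trans a U V : ft_cov a U -> ft_covs U V -> ft_cov a V.
Proof. exact: (cov_trans (ft_is_cover S)). Qed.

Lemma ftcov_sub a U V : U `<=` V -> ft_cov a U -> ft_cov a V.
Proof. by move=> UV aU; apply: ftcov_trans aU _ => b /UV; apply: ftcov_mem. Qed.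

Lemma ftcov_le a b U : ft_le a b -> ft_cov b U -> ft_cov a U.
Proof.
move=> ab bU; apply: ftcov_trans (cov_le (ft_is_cover S) ab) _.
by move=> _ ->.
Qed.

Lemma ftcov_down a U V : ft_cov a U -> ft_cov a V ->
  ft_cov a (down (@ft_le S) U V).
Proof. exact: (cov_down (ft_is_cover S)). Qed.

End CoverTheory.

Lemma fm_down_set (S T : ftop) (r : ftop_map S T) (U V : set T) :
  ft_covs (down (@ft_le S) (rpre r U) (rpre r V))
          (rpre r (down (@ft_le T) U V)).
Proof.
move=> c [a [u Uu au] [b [v Vv bv] [ca cb]]].
have : ft_cov c (rpre r (down (@ft_le T) [set u] [set v])).
  apply: (fm_down (fm_is_map r)).
  by exists a; [exists u | exists b => //; exists v].
apply: ftcov_sub => x [w [_ -> [_ -> [wu wv]]] xw].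
by exists w => //; exists u => //; exists v.
Qed.

Lemma fm_cov_set (S T : ftop) (r : ftop_map S T) (U V : set T) :
  ft_covs U V -> ft_covs (rpre r U) (rpre r V).
Proof.
by move=> UV a [u Uu au]; apply: (fm_cov (fm_is_map r) (UV u Uu)); exists u.
Qed.

Lemma ftop_comp_subproof (S T W : ftop)
    (s : ftop_map T W) (r : ftop_map S T) : is_ftop_map (rcomp s r).
Proof.
have E (D : set W) : rpre r (rpre s D) `<=` rpre (rcomp s r) D.
  by move=> a [b [c Dc bc] ab]; exists c => //; exists b.
have E' (D : set W) : rpre (rcomp s r) D `<=` rpre r (rpre s D).
  by move=> a [c Dc [b ab bc]]; exists b => //; exists c.
split.
- move=> a aT; apply: ftcov_sub (E _) _.
  apply: ftcov_trans (fm_total (fm_is_map r) aT) _.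
  apply: fm_cov_set => b _; exact: (fm_total (fm_is_map s)).
- move=> c d x [y /E' yc [z /E' zd [xy xz]]].
  have : ft_cov x (rpre r (down (@ft_le T) (rpre s [set c]) (rpre s [set d]))).
    by apply: fm_down_set; exists y => //; exists z.
  move=> h; apply: ftcov_sub (E _) _; apply: ftcov_trans h _.
  by apply: fm_cov_set; apply: (fm_down (fm_is_map s)).
- move=> c U cU x /E' xc; apply: ftcov_sub (E _) _.
  by apply: fm_cov_set xc; apply: (fm_cov (fm_is_map s)).
Qed.

Definition ftop_comp (S T W : ftop) (s : ftop_map T W) (r : ftop_map S T) :
    ftop_map S W :=
  FTopMap (ftop_comp_subproof s r).

(* [P] with the projections [pr] is a product of the family [F] in FTop. *)
Definition is_ftop_product (I : Type) (F : I -> ftop) (P : ftop)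
    (pr : forall i, ftop_map P (F i)) : Prop :=
  forall (T : ftop) (f : forall i, ftop_map T (F i)),
    exists2 h : ftop_map T P,
      forall i, ftop_map_eq (ftop_comp (pr i) h) (f i) &
      forall k : ftop_map T P,
        (forall i, ftop_map_eq (ftop_comp (pr i) k) (f i)) -> ftop_map_eq k h.

(** * Upper reals *)

Record ureal := UReal {
  ureal_mem :> {posnum rat} -> Prop;
  ureal_round : forall q,
    ureal_mem q <-> exists2 q', q'%:num < q%:num & ureal_mem q'
}.

Definition ureal_le (U V : ureal) : Prop := forall q, V q -> U q.

Definition ureal_eq (U V : ureal) : Prop := forall q, U q <-> V q.

Lemma ureal_up (U : ureal) (p q : {posnum rat}) :
  p%:num <= q%:num -> U p -> U q.
Proof.
move=> pq /ureal_round [p' p'p Up']; apply/ureal_round; exists p' => //.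
exact: lt_le_trans pq.
Qed.

Lemma ureal_rat_subproof (r : {nonneg rat}) (q : {posnum rat}) :
  r%:num < q%:num <->
  exists2 q' : {posnum rat}, q'%:num < q%:num & r%:num < q'%:num.
Proof.
split=> [rq|[q' q'q rq']]; last exact: lt_trans q'q.
have m0 : 0 < (r%:num + q%:num) / 2 by have := [ge0 of r%:num]; have := [gt0 of q%:num]; lra.
by exists (PosNum m0) => /=; lra.
Qed.

(* A non-negative rational seen as an upper real. *)
Definition ureal_rat (r : {nonneg rat}) : ureal :=
  UReal (ureal_rat_subproof r).

Lemma ureal_add_subproof (U V : ureal) (q : {posnum rat}) :
  (exists q1 q2 : {posnum rat}, [/\ U q1, V q2 & q%:num = q1%:num + q2%:num]) <->
  exists2 q' : {posnum rat}, q'%:num < q%:num &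
  exists q1 q2 : {posnum rat}, [/\ U q1, V q2 & q'%:num = q1%:num + q2%:num].
Proof.
split=> [[q1 [q2 [/ureal_round[p1 p1q1 Up1] Vq2 qE]]]|].
  by exists (p1%:num + q2%:num)%:pos; [rewrite qE /=; lra | exists p1, q2].
move=> [q' q'q [q1 [q2 [Uq1 Vq2 q'E]]]].
have p0 : 0 < q1%:num + (q%:num - q'%:num) by have := [gt0 of q1%:num]; lra.
exists (PosNum p0), q2; split => //=; last by lra.
by apply: ureal_up Uq1 => /=; lra.
Qed.

Definition ureal_add (U V : ureal) : ureal :=
  UReal (ureal_add_subproof U V).

Definition ureal_lt (U V : ureal) : Prop :=
  exists r : {posnum rat}, ureal_le (ureal_add U (ureal_rat r%:num%:nng)) V.

Lemma ureal_sup_subproof (F : set ureal) (q : {posnum rat}) :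
  (exists2 q' : {posnum rat}, q'%:num < q%:num & forall U, F U -> U q') <->
  exists2 p : {posnum rat}, p%:num < q%:num &
  exists2 q' : {posnum rat}, q'%:num < p%:num & forall U, F U -> U q'.
Proof.
split=> [[q' q'q FP]|[p pq [q' q'p FP]]]; last first.
  by exists q' => //; apply: lt_trans pq.
have m0 : 0 < (q'%:num + q%:num) / 2 by have := [gt0 of q%:num]; have := [gt0 of q'%:num]; lra.
by exists (PosNum m0) => /=; [lra | exists q' => //=; lra].
Qed.

(* Least upper bound for [ureal_le]: the rounded part of the intersection. *)
Definition ureal_sup (F : set ureal) : ureal := UReal (ureal_sup_subproof F).

Lemma ureal_sup_ub (F : set ureal) U : F U -> ureal_le U (ureal_sup F).
Proof. by move=> FU q [q' q'q FP]; apply/ureal_round; exists q' => //; apply: FP. Qed.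

Lemma ureal_sup_le (F : set ureal) V :
  (forall U, F U -> ureal_le U V) -> ureal_le (ureal_sup F) V.
Proof.
by move=> FV q /ureal_round[q' q'q Vq']; exists q' => // U FU; apply: FV.
Qed.

(** * Generalised uniform spaces *)

(* No symmetry and no separation; distances may be infinite (empty). *)
Record gmetric (X : Type) := GMetric {
  gdist :> X -> X -> ureal;
  gdist_refl : forall x, ureal_eq (gdist x x) (ureal_rat 0%:nng);
  gdist_tri : forall x y z,
    ureal_le (gdist x z) (ureal_add (gdist x y) (gdist y z))
}.
Arguments gdist_refl {X} d x : rename.
Arguments gdist_tri {X} d x y z : rename.

Definition gm_le (X : Type) (d e : gmetric X) : Prop :=
  forall x y, ureal_le (d x y) (e x y).

Lemma gm_le_refl (X : Type) (d : gmetric X) : gm_le d d.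
Proof. by move=> x y q. Qed.
#[local] Hint Resolve gm_le_refl : core.

Definition gm_eq (X : Type) (d e : gmetric X) : Prop :=
  forall x y, ureal_eq (d x y) (e x y).

(* Pointwise supremum of the [d t], for [t] in [A]. *)
Definition gm_sup_fun (X T : Type) (A : set T) (d : T -> gmetric X) (x y : X) :
    ureal :=
  ureal_sup [set d t x y | t in A].

Lemma gm_sup_refl X T (A : set T) (d : T -> gmetric X) x :
  ureal_eq (gm_sup_fun A d x x) (ureal_rat 0%:nng).
Proof.
move=> q; split=> [_|_]; first exact: [gt0 of q%:num].
have m0 : 0 < q%:num / 2 by have := [gt0 of q%:num]; lra.
exists (PosNum m0) => /=; first by have := [gt0 of q%:num]; lra.
by move=> _ [t _ <-]; apply/(gdist_refl (d t) x).
Qed.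

Lemma gm_sup_tri X T (A : set T) (d : T -> gmetric X) x y z :
  ureal_le (gm_sup_fun A d x z)
           (ureal_add (gm_sup_fun A d x y) (gm_sup_fun A d y z)).
Proof.
move=> q [q1 [q2 [[p1 pq1 P1] [p2 pq2 P2] qE]]].
exists (p1%:num + p2%:num)%:pos; first by rewrite qE /=; lra.
move=> _ [t At <-]; apply: (gdist_tri (d t) x y z _ _).
by exists p1, p2; split=> //; [apply: P1 | apply: P2]; exists t.
Qed.

Definition gm_sup (X T : Type) (A : set T) (d : T -> gmetric X) : gmetric X :=
  GMetric (@gm_sup_refl X T A d) (@gm_sup_tri X T A d).

(* [(x, y) |-> d (f x) (f y)] *)
Definition gm_pull (X Y : Type) (f : X -> Y) (d : gmetric Y) : gmetric X :=
  GMetric (gdist := fun x y => d (f x) (f y))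
    (fun x => gdist_refl d (f x))
    (fun x y z => gdist_tri d (f x) (f y) (f z)).

(* Metrics are compared extensionally, hence [gm_eq] in the closure under
   binary suprema. *)
Record gus := Gus {
  gus_car :> Type;
  gus_met : set (gmetric gus_car);
  gus_inh : gus_met !=set0;
  gus_sup2 : forall d e, gus_met d -> gus_met e ->
    exists2 s, gus_met s & gm_eq s (gm_sup [set d; e] id)
}.

(* [d omega_f rho] *)
Definition omega (X Y : Type) (f : X -> Y) (d : gmetric X) (rho : gmetric Y) :
    Prop :=
  forall x x', ureal_le (rho (f x) (f x')) (d x x').

Record gus_hom (X Y : gus) := GusHom {
  gh_fun :> X -> Y;
  gh_omega : forall rho, gus_met rho -> exists2 d, gus_met d & omega gh_fun d rho
}.

(** * Localic completion *)

(* [b_d(x, e)] *)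
Record ball (X : gus) := Ball {
  b_met : gmetric X;
  b_metP : gus_met b_met;
  b_rad : {posnum rat};
  b_ctr : X
}.

Definition ball_le (X : gus) (b a : ball X) : Prop :=
  gm_le (b_met a) (b_met b) /\
  ureal_le (ureal_add (b_met a (b_ctr a) (b_ctr b))
                      (ureal_rat (b_rad b)%:num%:nng))
           (ureal_rat (b_rad a)%:num%:nng).

Definition ball_lt (X : gus) (b a : ball X) : Prop :=
  gm_le (b_met a) (b_met b) /\
  ureal_lt (ureal_add (b_met a (b_ctr a) (b_ctr b))
                      (ureal_rat (b_rad b)%:num%:nng))
           (ureal_rat (b_rad a)%:num%:nng).

Inductive completion_ax (X : gus) (a : ball X) : set (ball X) -> Prop :=
| completion_U1 : completion_ax a [set b | ball_lt b a]
| completion_U2 (d : gmetric X) (dM : gus_met d) (e : {posnum rat}) :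
    completion_ax a [set Ball dM e x | x in [set: X]].

Section BallTheory.
Implicit Types (U : ureal) (p q : {posnum rat}).

Lemma addrat_leP U p q :
  ureal_le (ureal_add U (ureal_rat p%:num%:nng)) (ureal_rat q%:num%:nng) <->
  forall t : {posnum rat}, q%:num < t%:num ->
    exists2 u, U u & u%:num + p%:num < t%:num.
Proof.
split=> [h t qt | h t /= qt].
  have [u [v [Uu /= pv tE]]] := h t qt.
  by exists u => //; rewrite tE; lra.
have [u Uu up] := h t qt.
have v0 : 0 < t%:num - u%:num by have := [gt0 of p%:num]; lra.
by exists u, (PosNum v0); split=> //=; lra.
Qed.

Lemma addrat_ltP U p q :
  ureal_lt (ureal_add U (ureal_rat p%:num%:nng)) (ureal_rat q%:num%:nng) <->
  exists2 u, U u & u%:num + p%:num < q%:num.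
Proof.
split=> [[r h] | [u Uu up]].
  have t0 : 0 < q%:num + r%:num by [].
  have [w [v [[u [p' [Uu /= pp' wE]]] /= rv /= tE]]] :=
    h (PosNum t0) ltac:(rewrite /=; have := [gt0 of r%:num]; lra).
  by exists u => //; lra.
have r0 : 0 < q%:num - (u%:num + p%:num) by lra.
exists (PosNum r0) => t /= qt.
have v0 : 0 < (t%:num - q%:num) / 2 by lra.
have p'0 : 0 < p%:num + (t%:num - q%:num) / 2 by have := [gt0 of p%:num]; lra.
have s0 : 0 < u%:num + (p%:num + (t%:num - q%:num) / 2).
  by have := [gt0 of u%:num]; lra.
have w0 : 0 < q%:num - (u%:num + p%:num) + (t%:num - q%:num) / 2 by lra.
exists (PosNum s0), (PosNum w0); split=> /=; [|lra|lra].
by exists u, (PosNum p'0); split=> //=; lra.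
Qed.

Lemma gdist0 (X : Type) (d : gmetric X) x q : d x x q.
Proof. by apply/(gdist_refl d x); apply: [gt0 of q%:num]. Qed.

Variable X : gus.
Implicit Types a b c : ball X.

Lemma ball_leP b a : ball_le b a <->
  gm_le (b_met a) (b_met b) /\
  forall t : {posnum rat}, (b_rad a)%:num < t%:num ->
    exists2 u, b_met a (b_ctr a) (b_ctr b) u & u%:num + (b_rad b)%:num < t%:num.
Proof. by split=> -[h1 /addrat_leP h2]; split=> //; apply/addrat_leP. Qed.

Lemma ball_ltP b a : ball_lt b a <->
  gm_le (b_met a) (b_met b) /\
  exists2 u, b_met a (b_ctr a) (b_ctr b) u &
             u%:num + (b_rad b)%:num < (b_rad a)%:num.
Proof. by split=> -[h1 /addrat_ltP h2]; split=> //; apply/addrat_ltP. Qed.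

Lemma gdist_tri_mem (d : gmetric X) x y z p q (pq : {posnum rat}) :
  d x y p -> d y z q -> pq%:num = p%:num + q%:num -> d x z pq.
Proof. by move=> xy yz E; apply: (gdist_tri d x y z _ _); exists p, q. Qed.

Lemma ball_le_refl a : ball_le a a.
Proof.
apply/ball_leP; split=> // t rt.
have u0 : 0 < (t%:num - (b_rad a)%:num) / 2 by lra.
by exists (PosNum u0); [apply: gdist0 | rewrite /=; lra].
Qed.

Lemma ball_le_trans a b c : ball_le a b -> ball_le b c -> ball_le a c.
Proof.
move=> /ball_leP[m1 h1] /ball_leP[m2 h2]; apply/ball_leP.
split=> [x y q /m1/m2 //|t rt].
have [u ucb ub] := h2 t rt.
have s0 : 0 < t%:num - u%:num by have := [gt0 of (b_rad b)%:num]; lra.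
have [v vba va] := h1 (PosNum s0) ltac:(rewrite /=; lra).
exists (u%:num + v%:num)%:pos; last by move: va => /=; lra.
by apply: gdist_tri_mem ucb (m2 _ _ _ vba) _.
Qed.

Lemma ball_lt_le a b : ball_lt a b -> ball_le a b.
Proof.
move=> /ball_ltP[m [u uba ua]]; apply/ball_leP; split=> // t rt.
by exists u => //; lra.
Qed.

Lemma ball_le_lt_trans a b c : ball_le a b -> ball_lt b c -> ball_lt a c.
Proof.
move=> /ball_leP[m1 h1] /ball_ltP[m2 [u ucb ub]]; apply/ball_ltP.
split=> [x y q /m1/m2 //|].
have s0 : 0 < (b_rad c)%:num - u%:num by have := [gt0 of (b_rad b)%:num]; lra.
have [v vba va] := h1 (PosNum s0) ltac:(rewrite /=; lra).
exists (u%:num + v%:num)%:pos; last by move: va => /=; lra.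
by apply: gdist_tri_mem ucb (m2 _ _ _ vba) _.
Qed.

Lemma ball_lt_le_trans a b c : ball_lt a b -> ball_le b c -> ball_lt a c.
Proof.
move=> /ball_ltP[m1 [v vba va]] /ball_leP[m2 h2]; apply/ball_ltP.
split=> [x y q /m1/m2 //|].
have t0 : 0 < (b_rad c)%:num + ((b_rad b)%:num - (v%:num + (b_rad a)%:num)).
  by have := [gt0 of (b_rad c)%:num]; lra.
have [u ucb ub] := h2 (PosNum t0) ltac:(rewrite /=; lra).
exists (u%:num + v%:num)%:pos; last by move: ub => /=; lra.
by apply: gdist_tri_mem ucb (m2 _ _ _ vba) _.
Qed.

End BallTheory.

(* U(X) *)
Definition completion (X : gus) : ftop :=
  FTop (@ball_le_refl X) (@ball_le_trans X)
    (gen_cover_is_cover (@ball_le X) (@completion_ax X)).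

(* [r_f] *)
Definition completion_rel (X Y : gus) (f : gus_hom X Y)
    (a : ball X) (b : ball Y) : Prop :=
  omega f (b_met a) (b_met b) /\
  ball_lt (Ball (b_metP b) (b_rad a) (f (b_ctr a))) b.

Section CompletionMap.
Variables (X Y : gus) (f : gus_hom X Y).
Local Notation r := (completion_rel f).
Local Notation UX := (completion X).
Local Notation UY := (completion Y).

Lemma completion_relP a b : r a b <->
  omega f (b_met a) (b_met b) /\
  exists2 u, b_met b (b_ctr b) (f (b_ctr a)) u &
             u%:num + (b_rad a)%:num < (b_rad b)%:num.
Proof.
split=> -[w]; first by move=> /ball_ltP[_ h].
by move=> h; split=> //; apply/ball_ltP.
Qed.

Lemma completion_rel_le a a' b b' :
  ball_le a' a -> r a b -> ball_le b b' -> r a' b'.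
Proof.
move=> /ball_leP[m1 h1] /completion_relP[w [u ub ua]] /ball_leP[m2 h2].
apply/completion_relP; split=> [x x' q /m1/w/m2 //|].
set s := (b_rad b)%:num - (u%:num + (b_rad a)%:num).
have s0 : 0 < s by rewrite /s; lra.
have t1 : 0 < (b_rad a)%:num + s / 2 by have := [gt0 of (b_rad a)%:num]; lra.
have t2 : 0 < (b_rad b')%:num + s / 2 by have := [gt0 of (b_rad b')%:num]; lra.
have [v va va'] := h1 (PosNum t1) ltac:(rewrite /=; lra).
have [w' wb wb'] := h2 (PosNum t2) ltac:(rewrite /=; lra).
exists ((w'%:num + u%:num)%:pos%:num + v%:num)%:pos.
  have h : b_met b' (b_ctr b') (f (b_ctr a)) (w'%:num + u%:num)%:pos.
    exact: gdist_tri_mem wb (m2 _ _ _ ub) _.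
  exact: gdist_tri_mem h (m2 _ _ _ (w _ _ _ va)) _.
by move: va' wb'; rewrite /= /s; lra.
Qed.

Lemma gus_ub (Z : gus) (d e : gmetric Z) : gus_met d -> gus_met e ->
  exists2 s, gus_met s & [/\ gm_le d s, gm_le e s &
    forall x y q, d x y q -> e x y q -> s x y q].
Proof.
move=> dM eM; have [s sM sE] := gus_sup2 dM eM; exists s => //.
have sub (g : gmetric Z) : [set d; e] g -> gm_le g s.
  move=> g_ x y q /sE; apply: ureal_sup_ub.
  by exists g.
split; [by apply: sub; left | by apply: sub; right |].
move=> x y q dq eq; apply/sE.
move: dq eq => /ureal_round[p pq dp] /ureal_round[p' pq' ep'].
exists (if p%:num <= p'%:num then p' else p); first by case: ifP.
move=> _ [g [->|->] <-]; case: ifP => // h; first exact: ureal_up dp.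
by apply: ureal_up ep'; move/negbT: h; rewrite -ltNge => /ltW.
Qed.

Lemma completion_map_subproof : @is_ftop_map UX UY r.
Proof.
have memC (a : UX) (U : set UX) : U a -> ft_cov a U by apply: ftcov_mem.
have half (e : {posnum rat}) : 0 < e%:num / 2.
  by have := [gt0 of e%:num]; lra.
have downP (a b : UY) :
    down (@ft_le UX) (rpre r [set a]) (rpre r [set b]) `<=`
    rpre r (down (@ft_le UY) [set a] [set b]).
  move=> c [c1 [_ -> c1a] [c2 [_ -> c2b] [cc1 cc2]]].
  have [wa [u ua uc]] :=
    (completion_relP _ _).1 (completion_rel_le cc1 c1a (ball_le_refl a)).
  have [wb [v vb vc]] :=
    (completion_relP _ _).1 (completion_rel_le cc2 c2b (ball_le_refl b)).
  have [s sM [as_ bs sab]] := gus_ub (b_metP a) (b_metP b).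
  have [t [t0 ta tb]] : exists t : rat, [/\ 0 < t,
      u%:num + ((b_rad c)%:num + t) < (b_rad a)%:num &
      v%:num + ((b_rad c)%:num + t) < (b_rad b)%:num].
    set x := (b_rad a)%:num - (u%:num + (b_rad c)%:num).
    set y := (b_rad b)%:num - (v%:num + (b_rad c)%:num).
    have x0 : 0 < x by rewrite /x; lra.
    have y0 : 0 < y by rewrite /y; lra.
    case: (lerP x y) => xy; [exists (x / 2) | exists (y / 2)];
      by split; move: xy x0 y0; rewrite /x /y; lra.
  have r0 : 0 < (b_rad c)%:num + t by have := [gt0 of (b_rad c)%:num]; lra.
  exists (Ball sM (PosNum r0) (f (b_ctr c))).
    exists a => //; exists b => //; split; apply: ball_lt_le; apply/ball_ltP.
    - by split=> //; exists u.
    - by split=> //; exists v.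
  apply/completion_relP; split=> [x x' q cq|/=].
    by apply: sab; [apply: wa | apply: wb].
  by exists (PosNum (half (PosNum t0))); [apply: gdist0 | rewrite /=; lra].
split.
- move=> a _; have [rho rhoM] := gus_inh Y.
  have [d dM dw] := gh_omega f rhoM.
  have : ft_cov (a : UX) [set Ball dM 1%:pos x | x in [set: X]].
    by apply: gen_cover_ax; apply: completion_U2.
  apply: ftcov_sub => _ [x _ <-].
  exists (Ball rhoM 2%:pos (f x)) => //; apply/completion_relP; split=> //=.
  by exists (PosNum (half 1%:pos)); [apply: gdist0 | rewrite /=; lra].
- by move=> a b c /downP; apply: memC.
- move=> a U aU.
  pose cov (b : UY) (V : set UY) :=
    @ft_covs UX (rpre r [set b]) (rpre r V).
  have preV (V : set UY) x : rpre r V x -> exists2 b, V b & rpre r [set b] x.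
    by move=> [b Vb xb]; exists b => //; exists b.
  apply: (aU cov); first split.
  + by move=> V b Vb x [_ -> xb]; apply: memC; exists b.
  + move=> b V W bV VW x xb; apply: ftcov_trans (bV x xb) _ => y /preV[c Vc].
    exact: VW.
  + move=> b V W bV bW x xb.
    apply: ftcov_trans (ftcov_down (bV x xb) (bW x xb)) _.
    move=> y [c /preV[v Vv cv] [c' /preV[w Ww cw] [yc yc']]]; apply: memC.
    have [z [_ -> [_ -> [zv zw]]] yz] : rpre r (down (@ft_le UY) [set v] [set w]) y.
      by apply: downP; exists c => //; exists c'.
    by exists z => //; exists v => //; exists w.
  + move=> b c bc x [_ -> xb]; apply: memC; exists c => //.
    exact: completion_rel_le (ball_le_refl x) xb bc.
  + move=> b _ [|rho rhoM e] x [_ -> /completion_relP[w [u ub ux]]].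
      apply: memC; pose t := ((b_rad b)%:num - (u%:num + (b_rad x)%:num)) / 2.
      have t0 : 0 < t by rewrite /t; lra.
      have s0 : 0 < (b_rad x)%:num + t by have := [gt0 of (b_rad x)%:num]; lra.
      exists (Ball (b_metP b) (PosNum s0) (f (b_ctr x))).
        by apply/ball_ltP; split=> //; exists u => //=; rewrite /t; lra.
      apply/completion_relP; split=> //=.
      by exists (PosNum (half (PosNum t0))); [apply: gdist0 | rewrite /=; lra].
    have [d dM dw] := gh_omega f rhoM.
    have : ft_cov (x : UX)
        [set Ball dM (PosNum (half e)) y | y in [set: X]].
      by apply: gen_cover_ax; apply: completion_U2.
    apply: ftcov_sub => _ [y _ <-]; exists (Ball rhoM e (f y)); first by exists (f y).
    apply/completion_relP; split=> //=.
    exists (PosNum (half (PosNum (half e)))); first exact: gdist0.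
    by rewrite /=; have := [gt0 of e%:num]; lra.
Qed.

(* The action of the localic completion functor on morphisms. *)
Definition completion_map : ftop_map UX UY := FTopMap completion_map_subproof.

End CompletionMap.

(** * Products of generalised uniform spaces *)

(* [Fin^+(T)]: inhabited subsets that are images of some [{0, ..., n-1}]. *)
Definition finplus (T : Type) (A : set T) : Prop :=
  A !=set0 /\ exists (n : nat) (e : 'I_n -> T), forall t, A t <-> exists i, e i = t.

Section Product.
Variables (I : Type) (X : I -> gus).

Definition prod_idx : Type := {i : I & {d : gmetric (X i) | gus_met d}}.

(* The metric [(f, g) |-> sup {d (f i) (g i) | (i, d) \in A}]. *)
Definition prod_metric (A : set prod_idx) : gmetric (forall i, X i) :=
  gm_sup A (fun t =>
    gm_pull (fun f : forall i, X i => f (projT1 t)) (sval (projT2 t))).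

Definition prod_met : set (gmetric (forall i, X i)) :=
  [set e | exists2 A, finplus A & gm_eq e (prod_metric A)].

(* Without an index, [Fin^+] of the empty sum would be empty. *)
Lemma prod_met_inh (I0 : inhabited I) : prod_met !=set0.
Proof.
case: I0 => i; have [d dM] := gus_inh (X i).
pose t : prod_idx := existT _ i (exist _ d dM).
exists (prod_metric [set t]); exists [set t] => //.
split; first by exists t.
exists 1%N, (fun _ => t) => s; split=> [->|[_ <-] //].
by exists ord0.
Qed.

Lemma prod_met_sup2 d e : prod_met d -> prod_met e ->
  exists2 s, prod_met s & gm_eq s (gm_sup [set d; e] id).
Proof.
move=> [A [A0 [n [a aP]]] dA] [B [B0 [m [b bP]]] eB].
pose C : set prod_idx := [set t | A t \/ B t].
exists (prod_metric C).
  exists C => //; split; first by have [t At] := A0; exists t; left.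
  exists (n + m)%N.
  exists (fun i => match split i with inl j => a j | inr k => b k end) => t.
  split=> [[/aP[j <-]|/bP[k <-]]|[i]].
  - by exists (lshift m j); case: splitP => [j' /= /val_inj<- //|k /= jk];
      have := ltn_ord j; rewrite jk -ltn_subRL subnn.
  - by exists (rshift n k); case: splitP => [j' /= jk|k' /= /addnI/val_inj<- //];
      have := ltn_ord j'; rewrite -jk -ltn_subRL subnn.
  - case: (split i) => [j|k] <-; first by left; apply/aP; exists j.
    by right; apply/bP; exists k.
move=> f g q; split=> [/ureal_round[q' q'q [p pq' CP]]|[p pq DP]].
  exists q' => // _ [h [->|->] <-]; [apply/dA | apply/eB];
    exists p => // _ [t Tt <-]; apply: CP; exists t => //; by [left|right].
exists p => // _ [t [At|Bt] <-].
- have : d f g p by apply: DP; exists d => //; left.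
  by move/dA; apply: ureal_sup_ub; exists t.
- have : e f g p by apply: DP; exists e => //; right.
  by move/eB; apply: ureal_sup_ub; exists t.
Qed.

Definition gus_prod (I0 : inhabited I) : gus :=
  Gus (prod_met_inh I0) prod_met_sup2.

Lemma gus_proj_subproof (I0 : inhabited I) i (rho : gmetric (X i)) :
  gus_met rho ->
  exists2 d : gmetric (gus_prod I0), gus_met d &
    omega (fun f : gus_prod I0 => f i) d rho.
Proof.
move=> rhoM; pose t : prod_idx := existT _ i (exist _ rho rhoM).
exists (prod_metric [set t]).
  exists [set t] => //; split; first by exists t.
  exists 1%N, (fun _ => t) => s; split=> [->|[_ <-] //].
  by exists ord0.
by move=> f g; apply: ureal_sup_ub; exists t.
Qed.

Definition gus_proj (I0 : inhabited I) (i : I) : gus_hom (gus_prod I0) (X i) :=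
  GusHom (@gus_proj_subproof I0 i).

End Product.

(* Main.v *)
Require Import Defs.
From mathcomp Require Import all_boot all_order all_algebra.
From mathcomp Require Import interval_inference classical_sets.
From mathcomp Require Import lra.

(** A metric of the product involves only finitely many coordinates, so a ball
    of the product contains a finite intersection of cylinders over balls of the
    factors.  Maps [f i : T -> U(X_i)] are thus paired by relating [t] to [b]
    when [t] is covered by the [f i]-preimages of the bases of such cylinders,
    for some ball strictly inside [b].  To see that this is a map, one covers [t]
    by elements [t'] each having a point of the product whose relevant
    coordinates are centres of balls containing [t']: choose finitely many
    coordinates one at a time and take the rest from a given point [x0].  This is
    where inhabitedness and decidable equality of indices are needed; no choice
    principle is. *)

Set Implicit Arguments.
Unset Strict Implicit.
Unset Printing Implicit Defensive.

Import Order.TTheory GRing.Theory Num.Theory.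

Local Open Scope ring_scope.
Local Open Scope classical_set_scope.

#[local] Hint Resolve gm_le_refl : core.

(** * Covers by preimages under a formal topology map *)

Definition down_closed (S : ftop) (U : set S) : Prop :=
  forall a b, ft_le a b -> U b -> U a.

Lemma rpre_sub (S T : Type) (r : S -> T -> Prop) (U V : set T) :
  U `<=` V -> rpre r U `<=` rpre r V.
Proof. by move=> UV a [b Ub ab]; exists b => //; apply: UV. Qed.

Section MapCover.
Variables (S T : ftop) (r : ftop_map S T).
Implicit Types (a : S) (U V : set T).

Lemma ftmap_cov_trans a U V :
  ft_cov a (rpre r U) -> ft_covs U V -> ft_cov a (rpre r V).
Proof. by move=> aU UV; apply: ftcov_trans aU _; apply: fm_cov_set. Qed.

Lemma ftmap_cov_sub a U V :
  U `<=` V -> ft_cov a (rpre r U) -> ft_cov a (rpre r V).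
Proof. by move=> UV; apply: ftcov_sub; apply: rpre_sub. Qed.

Lemma ftmap_cov_le a b c :
  ft_le b c -> ft_cov a (rpre r [set b]) -> ft_cov a (rpre r [set c]).
Proof.
move=> bc ab; apply: ftmap_cov_trans ab _ => _ ->.
by apply: ftcov_le bc _; apply: ftcov_mem.
Qed.

Lemma ftmap_cov_setT a U : ft_covs setT U -> ft_cov a (rpre r U).
Proof. exact: ftmap_cov_trans (fm_total (fm_is_map r) (a := a) Logic.I). Qed.

Lemma ftmap_cov_down a U V : ft_cov a (rpre r U) -> ft_cov a (rpre r V) ->
  ft_cov a (rpre r (Defs.down (@ft_le T) U V)).
Proof.
by move=> aU aV; apply: ftcov_trans (ftcov_down aU aV) _; apply: fm_down_set.
Qed.

(** For down-closed [U] and [V], [down U V] lies in their intersection, so finite intersections are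
    reached by induction on an enumeration of [J]; the empty one is totality of [r]. *)
Lemma ftmap_cov_bigcap a (J : finType) (V : J -> set T) :
  (forall j, down_closed (V j)) -> (forall j, ft_cov a (rpre r (V j))) ->
  ft_cov a (rpre r (\bigcap_j V j)).
Proof.
move=> Vdown aV.
suff aVs (s : seq J) : ft_cov a (rpre r [set b | forall j, j \in s -> V j b]).
  apply: ftmap_cov_sub (aVs (enum J)) => b bV j _.
  by apply: bV; rewrite mem_enum.
elim: s => [|k s IHs].
  by apply: ftmap_cov_setT => b _; apply: ftcov_mem.
apply: ftmap_cov_sub (ftmap_cov_down (aV k) IHs).
move=> b [c Vc [c' Vc' [bc bc']]] j; rewrite inE => /predU1P[->|js].
  exact: Vdown bc Vc.
by apply: Vdown bc' _; apply: Vc'.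
Qed.

End MapCover.

(** * Roundedness and balls *)

Lemma ureal_finite_round (J : finType) (U : J -> ureal) (q : {posnum rat}) :
  (forall j, U j q) ->
  exists2 p : {posnum rat}, p%:num < q%:num & forall j, U j p.
Proof.
move=> Uq.
suff [p pq Up] : exists2 p : {posnum rat}, p%:num < q%:num &
    forall j, j \in enum J -> U j p.
  by exists p => // j; apply: Up; rewrite mem_enum.
elim: (enum J) => [|k s [p pq IHs]].
  have q0 : 0 < q%:num / 2 by have := [gt0 of q%:num]; lra.
  by exists (PosNum q0) => //=; have := [gt0 of q%:num]; lra.
have [p' p'q Up'] := (ureal_round (U k) q).1 (Uq k).
exists (if p%:num <= p'%:num then p' else p); first by case: ifP.
move=> j; rewrite inE => /predU1P[->|js]; case: ifP => // h.
- by apply: ureal_up Up'; move/negbT: h; rewrite -ltNge => /ltW.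
- by apply: ureal_up h _; apply: IHs.
- exact: IHs.
Qed.

Section Balls.
Variable X : gus.
Implicit Types (a b c : ball X) (x y : X) (p q : {posnum rat}).

Lemma ball_lt_rad (d : gmetric X) (dM : gus_met d) p q x :
  p%:num < q%:num -> ball_lt (Ball dM p x) (Ball dM q x).
Proof.
move=> pq; apply/ball_ltP; split=> //=.
have u0 : 0 < (q%:num - p%:num) / 2 by lra.
by exists (PosNum u0); [apply: gdist0 | rewrite /=; lra].
Qed.

(** The slack [r] allows a ball to be inserted strictly between [b] and [a]. *)
Lemma ball_lt_room b a : ball_lt b a -> exists r : {posnum rat},
  ball_lt (Ball (b_metP b) ((b_rad b)%:num + r%:num)%:pos (b_ctr b)) a.
Proof.
move=> /ball_ltP[m [u au ub]].
have r0 : 0 < ((b_rad a)%:num - (u%:num + (b_rad b)%:num)) / 2 by lra.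
by exists (PosNum r0); apply/ball_ltP; split=> //; exists u => //=; lra.
Qed.

Lemma ball_le_rad_num b a : ball_le b a -> (b_rad b)%:num <= (b_rad a)%:num.
Proof.
move=> /ball_leP[_ h]; rewrite leNgt; apply/negP => ab.
by have [u _] := h _ ab; have := [gt0 of u%:num]; lra.
Qed.

(* [d] need not be symmetric, so [Ball dM q x] itself may not lie in a ball
   around the centre of [b], whatever its radius. *)
Lemma ball_le_recenter b (d : gmetric X) (dM : gus_met d) q x :
  ball_le b (Ball dM q x) -> ball_le b (Ball dM q (b_ctr b)).
Proof.
move=> h; have /= bq := ball_le_rad_num h.
move: h => /ball_leP[/= m _]; apply/ball_leP; split=> //= t qt.
have u0 : 0 < (t%:num - q%:num) / 2 by lra.
by exists (PosNum u0); [apply: gdist0 | rewrite /=; lra].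
Qed.

Lemma ball_le_dist b a t : ball_le b a -> (b_rad a)%:num < t%:num ->
  b_met a (b_ctr a) (b_ctr b) t.
Proof.
move=> /ball_leP[_ h] /h[u au ut]; apply: ureal_up au.
by have := [gt0 of (b_rad b)%:num]; lra.
Qed.

Lemma balls_cover (d : gmetric X) (dM : gus_met d) q (U : set (ball X)) :
  (forall x, U (Ball dM q x)) -> @ft_covs (completion X) setT U.
Proof.
move=> h a _.
have : @ft_cov (completion X) a [set Ball dM q x | x in [set: X]].
  by apply: gen_cover_ax; apply: completion_U2.
by apply: ftcov_sub => _ [x _ <-].
Qed.

Lemma lt_balls_cover a : @ft_cov (completion X) a [set b | ball_lt b a].
Proof. by apply: gen_cover_ax; apply: completion_U1. Qed.

Definition lower (U : set (ball X)) : set (ball X) :=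
  [set b | exists2 c, U c & ball_le b c].

Lemma lower_down_closed (U : set (ball X)) :
  @down_closed (completion X) (lower U).
Proof.
by move=> a b ab [c Uc bc]; exists c => //; apply: ball_le_trans ab bc.
Qed.

End Balls.

(** * Metrics of the product as finite families *)

Section Product.
Variables (I : eqType) (I0 : inhabited I) (X : I -> gus).
Local Notation P := (gus_prod X I0).

Definition idx_met (e : prod_idx X) : gmetric (X (projT1 e)) := sval (projT2 e).

Lemma idx_metP (e : prod_idx X) : gus_met (idx_met e).
Proof. exact: (svalP (projT2 e)). Qed.

Definition idx_ball (e : prod_idx X) (q : {posnum rat}) (x : forall i, X i) :
    ball (X (projT1 e)) :=
  Ball (idx_metP e) q (x (projT1 e)).

Definition fam_metric (J : finType) (e : J -> prod_idx X) : gmetric P :=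
  prod_metric (range e).

Lemma fam_metricP (J : finType) (e : J -> prod_idx X) (x y : P) q :
  fam_metric e x y q <-> forall j, idx_met (e j) (x _) (y _) q.
Proof.
split=> [[p pq xy] j|xy].
  by apply: ureal_up (ltW pq) _; apply: xy; exists (e j) => //; exists j.
(* The supremum is the rounded part of an intersection, so a single [p] below [q] has to serve every
   [j]; finiteness of [J] provides it. *)
have [p pq xyp] :=
  @ureal_finite_round _ (fun j => idx_met (e j) (x _) (y _)) _ xy.
by exists p => // _ [_ [j _ <-] <-]; apply: xyp.
Qed.

Lemma prod_met_fam (d : gmetric P) : gus_met d ->
  exists (J : finType) (e : J -> prod_idx X),
    inhabited J /\ gm_eq d (fam_metric e).
Proof.
move=> [A [[t0 At0] [n [e eP]]] dA]; exists 'I_n, e; split.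
  by have [j _] := (eP t0).1 At0.
have AE U x y : [set gm_pull (fun f : forall i, X i => f (projT1 t))
      (sval (projT2 t)) x y | t in A] U <->
    [set gm_pull (fun f : forall i, X i => f (projT1 t))
      (sval (projT2 t)) x y | t in range e] U.
  split=> -[t h <-]; exists t => //; first by have [j <-] := (eP t).1 h; exists j.
  by apply/eP; have [j _ <-] := h; exists j.
by move=> x y q; split=> [/dA [p pq h]|[p pq h]]; [|apply/dA];
  exists p => // U /AE; apply: h.
Qed.

Lemma fam_metric_met (e : prod_idx X) :
  @gus_met P (fam_metric (fun _ : 'I_1 => e)).
Proof.
exists (range (fun _ : 'I_1 => e)); last by move=> x y q.
split; first by exists e; exists ord0.
by exists 1%N, (fun _ => e) => t; split=> [[j _ <-]|[j <-]]; exists j.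
Qed.

(** * Points of the product with prescribed coordinates *)

Variables (T : ftop) (f : forall i, ftop_map T (completion (X i))).
Implicit Types (t : T).

(** Coordinates are fixed one index at a time, starting from [x0]. Several [j] may share an index,
    and one centre must then serve them all: it is taken from a ball in the intersection of their
    [V j]. *)
Lemma cover_choose_point (x0 : P) t (J : finType) (i : J -> I)
    (V : forall j, set (ball (X (i j)))) :
  (forall j, @down_closed (completion (X (i j))) (V j)) ->
  (forall j, ft_cov t (rpre (f (i j)) (V j))) ->
  ft_cov t [set t' | exists z : P, forall j, exists c,
    [/\ V j c, b_ctr c = z (i j) & ft_cov t' (rpre (f (i j)) [set c])]].
Proof.
move=> Vdown tV.
suff tVs (s : seq I) : ft_cov t [set t' | exists z : P, forall j, i j \in s ->
    exists c,
    [/\ V j c, b_ctr c = z (i j) & ft_cov t' (rpre (f (i j)) [set c])]].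
  apply: ftcov_sub (tVs [seq i j | j <- enum J]) => t' [z zP].
  by exists z => j; apply: zP; rewrite map_f // mem_enum.
elim: s => [|k s IHs]; first by apply: ftcov_mem; exists x0.
(* [V j] transported to index [k], and no condition if [i j] differs from [k]. Decidable equality of
   indices separates the two cases and makes the transport independent of [E]. *)
pose Vk j : set (ball (X k)) :=
  [set c | forall E : k = i j, V j (eq_rect k (fun k => ball (X k)) c (i j) E)].
have tVk : ft_cov t (rpre (f k) (\bigcap_j Vk j)).
  apply: ftmap_cov_bigcap => j.
    move=> c c' cc' Vc' E; move: (Vc' E).
    by case: _ / E (V j) (Vdown j) => W; apply.
  case: (eqVneq k (i j)) => [E|/eqP kij].
    subst k; apply: ftmap_cov_sub (tV j) => c Vc E.
    by rewrite (eq_axiomK E).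
  by apply: ftmap_cov_setT => c _; apply: ftcov_mem => E; case: (kij E).
apply: ftcov_sub (ftcov_down IHs tVk).
move=> t' [t1 [z zP] [t2 [c cV t2c] [t't1 t't2]]].
(* If [k] already occurs in [s], its old centre is overwritten; nothing is lost, as [Vk] constrains
   every [j] with index [k]. *)
exists (dfwith z (b_ctr c)) => j; rewrite inE; case: (eqVneq (i j) k) => [E _|nE].
  subst k; exists c; split; first exact: cV j Logic.I erefl.
    by rewrite dfwith_in.
  by apply: ftcov_le t't2 _; apply: ftcov_mem; exists c.
move=> /= /zP[c' [Vc' zc' t1c']]; exists c'; split=> //.
  by rewrite dfwith_out // eq_sym.
exact: ftcov_le t't1 t1c'.
Qed.

(** * The pairing of a family of maps *)

(* [t] lies in the intersection of finitely many cylinders contained in [b]. *)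
Definition forced t (b : ball P) : Prop :=
  exists (J : finType) (e : J -> prod_idx X),
  [/\ inhabited J, gm_le (b_met b) (fam_metric e) &
      forall j, ft_cov t (rpre (f (projT1 (e j)))
                               [set idx_ball (e j) (b_rad b) (b_ctr b)])].

(** Passing to a larger ball makes the relation upward closed, and strictness leaves the room that
    axiom (U1) asks for. *)
Definition pair_rel t (b : ball P) : Prop :=
  exists2 b', forced t b' & ball_lt b' b.

Lemma forced_le t t' b : ft_le t t' -> forced t' b -> forced t b.
Proof.
move=> tt' [J [e [J0 be t'b]]]; exists J, e; split=> // j.
exact: ftcov_le tt' (t'b j).
Qed.

(** Each [V j] is refined by balls of radius [q] before the point is chosen; recentring these at [z]
    lets the same [z] meet both requirements. *)
Lemma cov_balls_point (x0 : P) t (J : finType) (e : J -> prod_idx X)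
    (V : forall j, set (ball (X (projT1 (e j))))) (q : {posnum rat}) :
  (forall j, @down_closed (completion (X (projT1 (e j)))) (V j)) ->
  (forall j, ft_cov t (rpre (f (projT1 (e j))) (V j))) ->
  ft_cov t [set t' | exists z : P,
    (forall j, exists2 c, V j c & b_ctr c = z _) /\
    forall j, ft_cov t' (rpre (f (projT1 (e j))) [set idx_ball (e j) q z])].
Proof.
move=> Vdown tV.
pose W j := V j `&` lower [set Ball (idx_metP (e j)) q x | x in setT].
have tW j : ft_cov t (rpre (f (projT1 (e j))) (W j)).
  have tC : ft_cov t (rpre (f (projT1 (e j)))
                           [set Ball (idx_metP (e j)) q x | x in setT]).
    apply: ftmap_cov_setT.
    by apply: (@balls_cover _ _ (idx_metP (e j))) => x; exists x.
  apply: ftmap_cov_sub (ftmap_cov_down (tV j) tC).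
  move=> c [c1 Vc1 [c2 Cc2 [cc1 cc2]]]; split; first exact: Vdown cc1 Vc1.
  by exists c2.
have Wdown j : @down_closed (completion (X (projT1 (e j)))) (W j).
  move=> c c' cc' [Vc' Cc']; split; first exact: Vdown cc' Vc'.
  exact: lower_down_closed cc' Cc'.
apply: ftcov_sub (cover_choose_point x0 Wdown tW) => t' [z zP].
exists z; split=> j; have [c [[Vc [_ [x _ <-] cx]] zc t'c]] := zP j.
  by exists c.
apply: ftmap_cov_le t'c; rewrite /idx_ball -zc.
exact: (@ball_le_recenter _ _ _ (idx_metP (e j)) _ _ cx).
Qed.

(** Serves both for totality and for axiom (U2). The point found is the centre of a forced ball of
    half the radius, which makes the inclusion strict. *)
Lemma pair_rel_balls (x0 : P) t (d : gmetric P) (dM : gus_met d) q :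
  ft_cov t (rpre pair_rel [set Ball dM q x | x in setT]).
Proof.
have q0 : 0 < q%:num / 2 by have := [gt0 of q%:num]; lra.
have [J [e [J0 de]]] := prod_met_fam dM.
have tT j : ft_cov t (rpre (f (projT1 (e j))) setT).
  by apply: ftmap_cov_setT => c _; apply: ftcov_mem.
have := @cov_balls_point x0 t J e (fun=> setT) (PosNum q0) (fun _ _ _ _ => id) tT.
apply: ftcov_sub => t' [z [_ t'z]]; exists (Ball dM q z); first by exists z.
exists (Ball dM (PosNum q0) z).
  by exists J, e; split=> //= x y p /de.
by apply: ball_lt_rad => /=; have := [gt0 of q%:num]; lra.
Qed.

Lemma pair_rel_up t a b : pair_rel t a -> ball_le a b -> pair_rel t b.
Proof. by move=> [a' ta' a'a] ab; exists a' => //; apply: ball_lt_le_trans ab. Qed.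

(** The two families are merged into one and a point [z] is chosen in the cylinders of both [a'] and
    [b']; a ball about [z] whose radius [r] fits into both slacks lies below [a] and [b]. *)
Lemma pair_rel_down a b :
  ft_covs (Defs.down (@ft_le T) (rpre pair_rel [set a]) (rpre pair_rel [set b]))
          (rpre pair_rel (Defs.down (@ball_le P) [set a] [set b])).
Proof.
move=> t [t1 [_ -> [a' t1a' a'a]] [t2 [_ -> [b' t2b' b'b]] [tt1 tt2]]].
have [J1 [e1 [[j1] a'e1 ta']]] := forced_le tt1 t1a'.
have [J2 [e2 [_ b'e2 tb']]] := forced_le tt2 t2b'.
have [ra ra_a] := ball_lt_room a'a.
have [rb rb_b] := ball_lt_room b'b.
have [r ra_r rb_r] : exists2 r : {posnum rat}, r%:num <= ra%:num & r%:num <= rb%:num.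
  by case: (lerP ra%:num rb%:num) => h; [exists ra | exists rb] => //; apply: ltW.
have s0 : 0 < r%:num / 2 by have := [gt0 of r%:num]; lra.
pose e (j : J1 + J2) := match j with inl j => e1 j | inr j => e2 j end.
pose c (j : J1 + J2) := if j is inl _ then a' else b'.
have te j : ft_cov t (rpre (f (projT1 (e j)))
    (lower [set idx_ball (e j) (b_rad (c j)) (b_ctr (c j))])).
  have h : ft_cov t (rpre (f (projT1 (e j)))
     [set idx_ball (e j) (b_rad (c j)) (b_ctr (c j))]) by case: j.
  apply: ftmap_cov_sub h => _ ->.
  exists (idx_ball (e j) (b_rad (c j)) (b_ctr (c j))) => //.
  exact: ball_le_refl.
(* The centre of [a] supplies the default point of the product. *)
have := @cov_balls_point (b_ctr a) t (J1 + J2)%type e _ (PosNum s0)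
  (fun j => @lower_down_closed _ _) te.
apply: ftcov_sub => t' [z [zc t'z]].
have zdist j q : (b_rad (c j))%:num < q%:num ->
    idx_met (e j) (b_ctr (c j) _) (z _) q.
  move=> cq; have [b0 [_ -> /ball_le_dist h] <-] := zc j.
  exact: h.
have [m mM [a'm b'm mE]] := gus_ub (b_metP a') (b_metP b').
exists (Ball mM r z).
  exists a => //; exists b => //; split; apply: ball_lt_le.
  - apply: ball_le_lt_trans ra_a; apply/ball_leP; split=> //= q aq.
    (* The midpoint of [b_rad a'] and [q - r]: it exceeds the former, so [zdist] applies, and stays
       below the latter because [r] is at most [ra]. *)
    have u0 : 0 < (q%:num - r%:num + (b_rad a')%:num) / 2.
      by have := [gt0 of (b_rad a')%:num]; lra.
    exists (PosNum u0); last by rewrite /=; lra.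
    apply: a'e1; apply/fam_metricP => j; apply: (zdist (inl j)) => /=; lra.
  - apply: ball_le_lt_trans rb_b; apply/ball_leP; split=> //= q bq.
    have u0 : 0 < (q%:num - r%:num + (b_rad b')%:num) / 2.
      by have := [gt0 of (b_rad b')%:num]; lra.
    exists (PosNum u0); last by rewrite /=; lra.
    apply: b'e2; apply/fam_metricP => j; apply: (zdist (inr j)) => /=; lra.
exists (Ball mM (PosNum s0) z); last first.
  by apply: ball_lt_rad => /=; have := [gt0 of r%:num]; lra.
exists (J1 + J2)%type, e; split=> //=; first by split; left.
move=> x y q /fam_metricP xy; apply: mE.
  by apply: a'e1; apply/fam_metricP => j; apply: (xy (inl j)).
by apply: b'e2; apply/fam_metricP => j; apply: (xy (inr j)).
Qed.

Lemma pair_rel_is_map (x0 : P) : @is_ftop_map T (completion P) pair_rel.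
Proof.
split.
- move=> t _; have [d dM] := gus_inh P.
  by apply: ftcov_sub (pair_rel_balls x0 t dM 1%:pos); apply: rpre_sub.
- exact: pair_rel_down.
- move=> a U aU.
  (* The cover of the completion is the least one, so it suffices that covering of preimages is a
     cover satisfying (U1) and (U2). *)
  pose cov b (V : set (ball P)) := ft_covs (rpre pair_rel [set b]) (rpre pair_rel V).
  have preV V t : rpre pair_rel V t -> exists2 b, V b & rpre pair_rel [set b] t.
    by move=> [b Vb tb]; exists b => //; exists b.
  apply: (aU cov); first split.
  + by move=> V b Vb t [_ -> tb]; apply: ftcov_mem; exists b.
  + move=> b V W bV VW t tb; apply: ftcov_trans (bV t tb) _ => t' /preV[c Vc].
    exact: VW.
  + move=> b V W bV bW t tb.
    apply: ftcov_trans (ftcov_down (bV t tb) (bW t tb)) _.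
    move=> t' [t1 /preV[v Vv t1v] [t2 /preV[w Ww t2w] [t't1 t't2]]].
    have /pair_rel_down : Defs.down (@ft_le T) (rpre pair_rel [set v])
      (rpre pair_rel [set w]) t' by exists t1 => //; exists t2.
    apply: ftcov_sub; apply: rpre_sub => c [_ -> [_ -> cvw]].
    by exists v => //; exists w.
  + move=> b c bc t [_ -> tb]; apply: ftcov_mem; exists c => //.
    exact: pair_rel_up tb bc.
  + move=> b _ [|d dM q] t [_ -> tb]; last exact: pair_rel_balls.
    apply: ftcov_mem; have [b' tb' b'b] := tb.
    have [r rb] := ball_lt_room b'b.
    exists (Ball (b_metP b') ((b_rad b')%:num + r%:num)%:pos (b_ctr b')) => //.
    exists b' => //; case: b' {tb' b'b rb} => d dM q x /=.
    by apply: ball_lt_rad => /=; have := [gt0 of r%:num]; lra.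
Qed.

Definition pair_map (x0 : P) : ftop_map T (completion P) :=
  FTopMap (pair_rel_is_map x0).

(** * The universal property *)

(* Evaluating along the section [y |-> dfwith x y] of the projection shows that
   only the members of the family with index [i] contribute. *)
Lemma forced_proj t (b : ball P) i (d : gmetric (X i)) (dM : gus_met d) :
  forced t b -> omega (gus_proj X I0 i) (b_met b) d ->
  ft_cov t (rpre (f i) [set Ball dM (b_rad b) (b_ctr b i)]).
Proof.
move=> [J [e [[j0] be tb]]] bd.
set q := b_rad b; set x := b_ctr b.
pose upd (y : X i) : P := dfwith x y.
(* Balls whose image under [upd], measured by [e j] alone, lies in the [q]-ball about [x]. At an
   index other than [i] that coordinate of [upd] is constantly that of [x], so every ball of radius
   [q] qualifies. *)
pose V j : set (ball (X i)) :=
  [set c | omega (fun y => upd y (projT1 (e j))) (b_met c) (idx_met (e j)) /\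
    forall s : {posnum rat}, q%:num < s%:num ->
      exists2 u, idx_met (e j) (x _) (upd (b_ctr c) _) u &
                 u%:num + (b_rad c)%:num < s%:num].
have Vdown j : @down_closed (completion (X i)) (V j).
  move=> c' c /ball_leP[m h] [om hc]; split=> [y y' p /m/om //|s qs].
  have [u xu us] := hc s qs.
  have s0 : 0 < s%:num - u%:num by have := [gt0 of (b_rad c)%:num]; lra.
  have [v cv vs] := h (PosNum s0) ltac:(rewrite /=; lra).
  exists (u%:num + v%:num)%:pos; last by move: vs => /=; lra.
  exact: gdist_tri_mem xu (om _ _ _ cv) _.
have tV j : ft_cov t (rpre (f i) (V j)).
  have half (s : {posnum rat}) : q%:num < s%:num -> 0 < (s%:num - q%:num) / 2.
    by lra.
  case: (eqVneq i (projT1 (e j))) => [E|nE].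
    subst i; apply: ftmap_cov_sub (tb j) => _ ->; split=> [y y' p|s qs] /=.
      by rewrite /upd !dfwith_in.
    exists (PosNum (half s qs)); last by rewrite /=; lra.
    by rewrite /upd dfwith_in; apply: gdist0.
  apply: ftmap_cov_setT; apply: (@balls_cover (X i) d dM q) => y.
  split=> [y1 y2 p _|s qs] /=; first by rewrite /upd !dfwith_out //; apply: gdist0.
  exists (PosNum (half s qs)); last by rewrite /=; lra.
  by rewrite /upd dfwith_out //; apply: gdist0.
apply: ftmap_cov_trans (ftmap_cov_bigcap Vdown tV) _ => c cV.
apply: ftcov_le (ftcov_mem _) => //; apply/ball_leP; split=> [y y' p cp|s qs] /=.
  have : fam_metric e (upd y) (upd y') p.
    by apply/fam_metricP => j; have [om _] := cV j Logic.I; apply: om.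
  by move=> /be /bd /=; rewrite /upd !dfwith_in.
(* The distances vary with [j], but each plus [b_rad c] stays below the midpoint of [q] and [s]. The
   midpoint minus [b_rad c], positive since [J] is inhabited, thus bounds them all. *)
have m0 : 0 < (q%:num + s%:num) / 2 by have := [gt0 of q%:num]; lra.
have qm : q%:num < (PosNum m0)%:num by rewrite /=; lra.
have w0 : 0 < (PosNum m0)%:num - (b_rad c)%:num.
  have [_ /(_ _ qm) [u0 _]] := cV j0 Logic.I.
  by have := [gt0 of u0%:num]; lra.
exists (PosNum w0); last by rewrite /=; lra.
have : fam_metric e x (upd (b_ctr c)) (PosNum w0).
  apply/fam_metricP => j; have [_ /(_ _ qm) [u xu us]] := cV j Logic.I.
  by apply: ureal_up xu => /=; move: us => /=; lra.
by move=> /be /bd /=; rewrite /upd dfwith_in.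
Qed.

Lemma pair_map_proj (x0 : P) i :
  ftop_map_eq (ftop_comp (completion_map (gus_proj X I0 i)) (pair_map x0)) (f i).
Proof.
move=> b; split=> t [_ -> /=].
  move=> [c [c' tc' c'c] cb].
  have := completion_rel_le (ball_lt_le c'c) cb (ball_le_refl b).
  move=> [om /ball_lt_le c'b].
  apply: (@ftmap_cov_le _ _ (f i) _ _ _ c'b).
  by apply: (forced_proj (b_metP b) tc' om).
move=> tb; have tbs : ft_cov t (rpre (f i) [set c | ball_lt c b]).
  by apply: (fm_cov (fm_is_map (f i)) (lt_balls_cover b)); exists b.
apply: ftcov_trans tbs _ => {tb}t [c cb tc]; apply: ftcov_mem.
have [r rb] := ball_lt_room cb.
(* The cylinder over [c], as a ball of the product for a one-member family. The slack [r] separates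
   the forced ball, of radius [b_rad c], from the ball that projects strictly into [b]. *)
pose e : prod_idx X := existT _ i (exist _ (b_met c) (b_metP c)).
pose z : P := dfwith x0 (b_ctr c).
pose B q := Ball (fam_metric_met e) q z : ball P.
exists b => //; exists (B ((b_rad c)%:num + r%:num)%:pos).
  exists (B (b_rad c)).
    exists 'I_1, (fun=> e); split=> //= [|_]; first by split; exact: ord0.
    apply: (@ftmap_cov_le _ _ (f i) _ c); last by apply: ftcov_mem; exists c.
    by rewrite /idx_ball /= /z dfwith_in; apply: (ball_le_refl c).
  by apply: ball_lt_rad => /=; have := [gt0 of r%:num]; lra.
have [m _] := ball_lt_le rb.
split.
  by move=> x y q /fam_metricP /(_ ord0) /m.
by rewrite /= /z dfwith_in; case: rb => _ h; split.
Qed.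

(** By (U1), [b] shrinks to some [c], which projects into slightly enlarged bases of its finitely
    many cylinders; there [k] is governed by [f]. Conversely, [f] forces [k] to cover [t] by each
    set [V j] of balls projecting into the [j]-th base, and the intersection of these sets lies
    below [c]. *)
Lemma pair_map_unique (x0 : P) (k : ftop_map T (completion P)) :
  (forall i,
    ftop_map_eq (ftop_comp (completion_map (gus_proj X I0 i)) k) (f i)) ->
  ftop_map_eq k (pair_map x0).
Proof.
move=> kf b; split=> t [_ ->].
  move=> tb; have tbs : ft_cov t (rpre k [set c | ball_lt c b]).
    by apply: (fm_cov (fm_is_map k) (lt_balls_cover b)); exists b.
  apply: ftcov_trans tbs _ => {tb}t [c cb tc]; apply: ftcov_mem.
  have [r rb] := ball_lt_room cb.
  (* The forced ball is [c] with radius enlarged by [r], since [c] projects only into strictly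
     larger balls. *)
  exists b => //; eexists; last exact: rb.
  have [J [e [J0 ce]]] := prod_met_fam (b_metP c).
  exists J, e; split=> // [x y q /ce //|j].
  have [/(_ t) h _] := kf _ (idx_ball (e j) ((b_rad c)%:num + r%:num)%:pos (b_ctr c)).
  apply: h; eexists; first by [].
  exists c => //; split=> /=.
    by move=> x y q /ce/fam_metricP/(_ j).
  by apply: ball_lt_rad => /=; have := [gt0 of r%:num]; lra.
move=> [c [J [e [[j0] ce tc]]] cb].
pose V j : set (ball P) :=
  [set c' | completion_rel (gus_proj X I0 (projT1 (e j))) c'
    (idx_ball (e j) (b_rad c) (b_ctr c))].
have Vdown j : @down_closed (completion P) (V j).
  by move=> c1 c2 c12 h; apply: completion_rel_le c12 h (ball_le_refl _).
have tV j : ft_cov t (rpre k (V j)).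
  apply: ftcov_trans (tc j) _ => t' t'c.
  have [_ /(_ t' t'c)] := kf _ (idx_ball (e j) (b_rad c) (b_ctr c)).
  by apply: ftcov_sub => t2 [_ -> [c' t2c' c'V]]; exists c'.
suff h : ft_cov t (rpre k [set c]) by apply: ftmap_cov_le h; apply: ball_lt_le.
apply: ftmap_cov_trans (ftmap_cov_bigcap Vdown tV) _ => c' c'V.
apply: ftcov_le (ftcov_mem _) => //; apply/ball_leP; split=> [x y q xy|q cq].
  by apply: ce; apply/fam_metricP => j; have [om _] := c'V j Logic.I; apply: om.
have c'r j : exists2 u : {posnum rat},
    idx_met (e j) (b_ctr c _) (b_ctr c' _) u &
    u%:num + (b_rad c')%:num < (b_rad c)%:num.
  by have [_ /ball_ltP[_]] := c'V j Logic.I.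
have w0 : 0 < (b_rad c)%:num - (b_rad c')%:num.
  by have [u _] := c'r j0; have := [gt0 of u%:num]; lra.
exists (PosNum w0); last by rewrite /=; lra.
apply: ce; apply/fam_metricP => j; have [u cu uc] := c'r j.
by apply: ureal_up cu => /=; lra.
Qed.

End Product.

Theorem proposition3p15 (X : nat -> gus)
    (X_inh : inhabited (forall n : nat, X n)) :
  is_ftop_product
    (F := fun n => completion (X n))
    (P := completion (gus_prod X (inhabits 0%N)))
    (fun n => completion_map (gus_proj X (inhabits 0%N) n)).
Proof.
move=> T f; case: X_inh => x0.
exists (pair_map f x0) => [i|k kf]; first exact: pair_map_proj.
exact: pair_map_unique.
Qed.
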